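(* Let $B_\infty$ be the generalized Bratteli diagram with $V_n=\mathbb N=\{1,2,\ldots\}$ for all $n\in\mathbb N$, in which there is exactly one edge from $i\in V_n$ to $j\in V_{n+1}$ if $j\ge i$, and no edge otherwise. For $0<a<\infty$ let $\mu_a$ be the tail invariant probability measure on the path space $X_{B_\infty}$ such that $$\mu_a([\overline e])=\frac{a^{i-1}}{(a+1)^{n+i-1}}$$ for every finite path $\overline e$ from $V_1$ to $i\in V_n$, $n,i\in\mathbb N$. Then the family of measures $\{\mu_a:0<a<\infty\}$ forms the set of all (non-atomic) ergodic probability tail invariant measures on $B_\infty$.
   Context: The path space $X_{B_\infty}$ is the set of infinite paths starting at $V_1$, with topology generated by cylinder sets $[\overline e]$ (infinite paths with prescribed finite initial path $\overline e$ starting in $V_1$; a path of length $0$ is a vertex of $V_1$). Two infinite paths are tail equivalent if they coincide from some level on. A Borel measure on $X_{B_\infty}$ is tail invariant if it takes equal values on the cylinder sets of any two finite paths starting in $V_1$ with the same terminal vertex; a tail invariant probability measure is ergodic if every Borel set that is a union of tail equivalence classes has measure $0$ or $1$. Convention: the term measure always means a non-atomic positive Borel measure. *)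

(* Defs.v *)
From HB Require Import structures.
From mathcomp Require Import all_boot all_order all_algebra.
From mathcomp Require Import all_classical all_reals all_analysis.

Set Implicit Arguments.
Unset Strict Implicit.
Unset Printing Implicit Defensive.

Import Order.TTheory GRing.Theory Num.Theory.

Local Open Scope classical_set_scope.
Local Open Scope ring_scope.

(* The edges of B_oo between two consecutive levels. The diagram is stationary,
   so the same type serves all levels. The vertices are the positive natural
   numbers; an edge is determined by its end points since the fields are
   boolean. *)
Record edge := Edge {
  src : nat;
  tgt : nat;
  src_gt0 : (0 < src)%N;
  src_le_tgt : (src <= tgt)%N }.

(* x k is the edge from level V_(k+1) to level V_(k+2): levels start at 1. *)
Definition is_path (x : nat -> edge) := forall k : nat, tgt (x k) = src (x k.+1).

Record path_space := InfinitePath {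
  edges :> nat -> edge;
  edgesP : is_path edges }.

HB.instance Definition _ := gen_eqMixin path_space.
HB.instance Definition _ := gen_choiceMixin path_space.

Definition edge11 : edge := @Edge 1 1 isT (leqnn 1).
Definition path11 : path_space := @InfinitePath (fun=> edge11) (fun=> erefl).
HB.instance Definition _ := isPointed.Build path_space path11.

(* finite_path n i is the type of the finite paths from V_1 to the vertex i of V_n;
   it is empty when n = 0 or i = 0. *)
Inductive finite_path : nat -> nat -> Type :=
| FPathVertex (i : nat) : (0 < i)%N -> finite_path 1 i
| FPathRcons (n : nat) (e : edge) : finite_path n.+1 (src e) -> finite_path n.+2 (tgt e).

Fixpoint cylinder (n i : nat) (p : finite_path n i) : set path_space :=
  match p with
  | FPathVertex i _ => [set x | src (x 0%N) = i]
  | FPathRcons n e q => cylinder q `&` [set x | x n = e]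
  end.

Definition cylinders : set (set path_space) :=
  [set C | exists n i (p : finite_path n i), C = cylinder p].

HB.instance Definition _ := @isSubBaseTopological.Build path_space
  (set path_space) cylinders id.

Definition borel_path_space := g_sigma_algebraType (@open path_space).

Definition tail_equivalent (x y : path_space) :=
  exists N : nat, forall k : nat, (N <= k)%N -> x k = y k.

Definition tail_saturated (A : set path_space) :=
  forall x y : path_space, tail_equivalent x y -> A x -> A y.

Section measures.
Context {R : realType}.
Implicit Types mu nu : probability borel_path_space R.
Local Open Scope ereal_scope.

Definition borel_eq mu nu :=
  forall A : set borel_path_space, measurable A -> mu A = nu A.

Definition non_atomic mu :=
  forall A : set borel_path_space, measurable A -> 0 < mu A ->
  exists B : set borel_path_space,
    [/\ measurable B, B `<=` A, 0 < mu B & mu B < mu A].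

Definition tail_invariant mu :=
  forall (n i : nat) (p q : finite_path n i), mu (cylinder p) = mu (cylinder q).

Definition ergodic mu :=
  forall A : set borel_path_space, measurable A -> tail_saturated A ->
    mu A = 0 \/ mu A = 1.

Definition is_mu (a : R) mu :=
  tail_invariant mu /\
  forall (n i : nat) (p : finite_path n i),
    mu (cylinder p) = (a ^+ (i - 1) / (a + 1) ^+ (n + i - 1))%R%:E.

End measures.

(* Main.v *)
From HB Require Import structures.
Require Import Defs.
From mathcomp Require Import all_boot all_order all_algebra.
From mathcomp Require Import finmap.
From mathcomp Require Import all_classical all_reals all_analysis.
From mathcomp Require Import lra ring.

(** An infinite path is a nondecreasing sequence of positive integers, its
    vertices v_0 <= v_1 <= ..., and a measure is tail invariant when the mass of
    the cylinder of a prefix depends only on the length and the last vertex of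
    the prefix. Under mu_a the increments v_0 - 1, v_1 - v_0, ... are
    independent geometric variables of parameter c = a / (a + 1): a cylinder
    of n + 1 vertices ending at i has mass c^(i-1) (1-c)^(n+1).

    Cylinders form a countable basis closed under intersection, up to the
    empty set, so they determine finite Borel measures
    (measure_cylinder_unique).

    From ergodic to geometric. Write g(n, i) for the mass of a cylinder of n + 1
    vertices ending at i. Splitting cylinders according to their next vertex
    gives g(n, i) = g(n, i+1) + g(n+1, i) (cylinder_mass_harmonic). Both terms
    on the right are the masses of tail invariant measures, the images of nu
    under lowering all vertices by one, on the paths starting above 1, and
    under deleting the first vertex, on the paths starting at 1. Their sum is
    nu, so each of them is below nu. An ergodic measure is extremal: a tail
    invariant m <= nu is a multiple of nu (ergodic_extremal). This is proved
    with a Hahn set of m and m(X) nu, which stays a Hahn set when saturated,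
    because a saturation is a countable union of images under exchanges of
    prefixes, and these preserve both measures. Hence g(n, i+1) = c g(n, i)
    and g(n+1, i) = (1-c) g(n, i), with 0 <= c <= 1 (ergodic_cylinder_mass).
    The value c = 0 is the Dirac mass on the path staying at the vertex 1, and
    c = 1 would give total mass zero.

    From geometric to ergodic. For a tail saturated A, the measure
    mu(A /\ _) is tail invariant, so its cylinder masses divided by those
    of mu form a bounded solution h of
    h(n, s) = c h(n, s+1) + (1-c) h(n+1, s). Such a function is constant
    (bounded_harmonic_constant), which makes A independent of every Borel set,
    in particular of itself. Non-atomicity holds since cylinder masses
    are at most (1-c)^(n+1).

    The measures exist because the geometric cylinders can be realised by
    nested subintervals of [0, 1[, and Lebesgue measure transported
    (geometric_measure_exists). *)

Set Implicit Arguments.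
Unset Strict Implicit.
Unset Printing Implicit Defensive.

Import Order.TTheory GRing.Theory Num.Theory.
Import numFieldNormedType.Exports.
Local Open Scope classical_set_scope.
Local Open Scope ring_scope.

(** * Paths as sequences of vertices *)

Definition vertex (x : path_space) (k : nat) : nat := src (x k).

Lemma vertex_gt0 x k : (0 < vertex x k)%N.
Proof. exact: src_gt0. Qed.

Lemma tgt_vertex (x : path_space) k : tgt (x k) = vertex x k.+1.
Proof. exact: edgesP. Qed.

Lemma vertexS x k : (vertex x k <= vertex x k.+1)%N.
Proof. by rewrite -tgt_vertex; exact: src_le_tgt. Qed.

Lemma edge_ext (e f : edge) : src e = src f -> tgt e = tgt f -> e = f.
Proof.
case: e f => [s t s0 st] [s' t' s0' st'] /= es et; subst s' t'.
by rewrite (bool_irrelevance s0 s0') (bool_irrelevance st st').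
Qed.

Lemma edge_vertex_ext (x y : path_space) k :
  vertex x k = vertex y k -> vertex x k.+1 = vertex y k.+1 -> x k = y k.
Proof. by move=> ? ?; apply: edge_ext => //; rewrite !tgt_vertex. Qed.

Lemma path_ext (x y : path_space) :
  (forall k, vertex x k = vertex y k) -> x = y.
Proof.
move=> xy; have : edges x = edges y :> (nat -> edge).
  by apply/funext => k; exact: edge_vertex_ext.
case: x y {xy} => [x px] [y py] /= exy; subst y.
by rewrite (Prop_irrelevance px py).
Qed.

Section path_of.
Variable v : nat -> nat.

(** Building paths from a running maximum makes [path_of] total: every sequence
    of numbers yields a path, and the sequences that are already vertex
    sequences are left unchanged. *)
Fixpoint running_max (k : nat) : nat :=
  if k is k'.+1 then maxn (running_max k') (v k) else maxn 1 (v 0).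

Lemma running_max_gt0 k : (0 < running_max k)%N.
Proof. by elim: k => [|k IH] /=; rewrite leq_max ?IH. Qed.

Lemma running_maxS k : (running_max k <= running_max k.+1)%N.
Proof. exact: leq_maxl. Qed.

Definition path_of : path_space :=
  @InfinitePath (fun k => Edge (running_max_gt0 k) (running_maxS k))
    (fun=> erefl).

Lemma vertex_path_of k : (0 < v 0)%N ->
  (forall j, (j < k)%N -> (v j <= v j.+1)%N) -> vertex path_of k = v k.
Proof.
rewrite /vertex /= => v0; elim: k => [|k IH] vk /=; first exact/maxn_idPr.
rewrite IH; last by move=> j jk; apply: vk; exact: ltnW.
by apply/maxn_idPr/vk.
Qed.

End path_of.

(** Only the first n + 1 values of v matter, so a path may be cut after a prefix
    and continued in any way. *)
Lemma vertex_path_of_prefix (x : path_space) v n :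
  (forall k, (k <= n)%N -> v k = vertex x k) ->
  forall k, (k <= n)%N -> vertex (path_of v) k = vertex x k.
Proof.
move=> vx k kn; rewrite vertex_path_of ?vx// ?vertex_gt0// => j jk.
by rewrite !vx ?vertexS// ?(leq_trans _ kn)// ltnW.
Qed.

(** Its cylinders are the reference cylinders ending at the vertex i. *)
Definition const_path (i : nat) : path_space := path_of (fun=> i).

Lemma vertex_const_path i k : (0 < i)%N -> vertex (const_path i) k = i.
Proof. by move=> i0; rewrite vertex_path_of. Qed.

(** Cylinders indexed by a path and a length rather than by a dependently typed
    finite path; [cylinderE] and [prefix_cylinderE] translate. *)
Definition prefix_cylinder (x : path_space) (n : nat) : set path_space :=
  [set y | forall k, (k <= n)%N -> vertex y k = vertex x k].

Lemma prefix_cylinder_eq {x y n} : prefix_cylinder x n y ->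
  prefix_cylinder y n = prefix_cylinder x n.
Proof.
move=> xy; apply/seteqP; split=> z /= h k kn; first by rewrite h// xy.
by rewrite h// xy.
Qed.

Lemma prefix_cylinder_le x m n : (m <= n)%N ->
  prefix_cylinder x n `<=` prefix_cylinder x m.
Proof. by move=> mn y h k km; apply: h; exact: leq_trans mn. Qed.

Lemma prefix_cylinderS x n : prefix_cylinder x n.+1 =
  prefix_cylinder x n `&` [set y | y n = x n].
Proof.
apply/seteqP; split=> y /=.
  move=> h; split; first by move=> k kn; apply: h; exact: leqW.
  by apply: edge_vertex_ext; apply: h.
move=> [h yx] k; rewrite leq_eqVlt => /predU1P[->|]; last exact: h.
by rewrite -!tgt_vertex yx.
Qed.

Lemma prefix_cylinderI x y m n : (m <= n)%N ->
  prefix_cylinder x m `&` prefix_cylinder y n =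
    (if `[< prefix_cylinder x m y >] then prefix_cylinder y n else set0).
Proof.
move=> mn; case: asboolP => xy.
  by apply/setIidPr; rewrite -(prefix_cylinder_eq xy); exact: prefix_cylinder_le.
apply/seteqP; split=> // z [xz yz]; apply: xy => k km.
by rewrite -(xz _ km) -yz// (leq_trans km).
Qed.

Lemma cylinderE n i (p : finite_path n i) : exists x k,
  [/\ n = k.+1, i = vertex x k & cylinder p = prefix_cylinder x k].
Proof.
elim: p => [j j0|m e q [x [k [[mk] ei cq]]]].
  exists (const_path j), 0%N; split => //; rewrite ?vertex_const_path//.
  apply/seteqP; split=> y /=.
    by rewrite -[src _]/(vertex y 0) => yj [|//] _; rewrite vertex_const_path.
  by move=> /(_ 0 isT); rewrite vertex_const_path.
subst k.
pose y := path_of (fun k => if (k <= m)%N then vertex x k else tgt e).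
have yx k : (k <= m)%N -> vertex y k = vertex x k.
  by apply: vertex_path_of_prefix => j ->.
have ye : vertex y m.+1 = tgt e.
  rewrite /y vertex_path_of ?ltnn ?vertex_gt0// => j.
  rewrite ltnS => jm; rewrite jm; case: ltnP => // [_|]; first exact: vertexS.
  move=> mj; rewrite (_ : j = m) -?ei ?src_le_tgt//.
  by apply/eqP; rewrite eqn_leq jm.
have yme : y m = e.
  by apply: edge_ext; [rewrite -[LHS]/(vertex y m) yx ?ei|rewrite tgt_vertex].
exists y, m.+1; split => //=; rewrite prefix_cylinderS yme cq.
by rewrite (@prefix_cylinder_eq x y)// => k /yx.
Qed.

Lemma prefix_cylinderE x k : exists p : finite_path k.+1 (vertex x k),
  cylinder p = prefix_cylinder x k.
Proof.
elim: k => [|k [q cq]].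
  exists (FPathVertex (vertex_gt0 x 0)) => /=; apply/seteqP; split=> y /=.
    by move=> yx [|//] _.
  by move=> /(_ 0 isT).
rewrite -tgt_vertex.
by exists (FPathRcons (e := x k) q) => /=; rewrite cq prefix_cylinderS.
Qed.

(** * Borel sets of the path space *)

Lemma open_prefix_cylinder x n : open (prefix_cylinder x n).
Proof.
have [p <-] := prefix_cylinderE x n.
have cp : cylinders (cylinder p) by exists n.+1, (vertex x n), p.
exists [set cylinder p]; last by rewrite bigcup_set1.
by move=> _ ->; exact: (finI_from1 id cp).
Qed.

Lemma common_cylinder x (s : seq (set path_space)) :
  (forall C, C \in s -> exists n, prefix_cylinder x n `<=` C) ->
  exists n, forall C, C \in s -> prefix_cylinder x n `<=` C.
Proof.
elim: s => [_|C s IH cs]; first by exists 0%N.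
have [n nC] := cs C (mem_head _ _).
have [k ks] : exists k, forall D, D \in s -> prefix_cylinder x k `<=` D.
  by apply: IH => D Ds; apply: cs; rewrite inE Ds orbT.
exists (maxn n k) => E; rewrite inE => /predU1P[->|/ks kE].
  by move=> z /(prefix_cylinder_le (leq_maxl n k))/nC.
by move=> z /(prefix_cylinder_le (leq_maxr n k))/kE.
Qed.

(** Cylinders around x are nested, so a finite intersection of subbasic
    cylinders contains a single cylinder around x. *)
Lemma open_sub_cylinder (A : set path_space) x : open A -> A x ->
  exists n, prefix_cylinder x n `<=` A.
Proof.
move=> [D DA <-] [B DB Bx].
suff [n nB] : exists n, prefix_cylinder x n `<=` B.
  by exists n => y /nB By; exists B.
have [F Fc FB] : finI_from cylinders id B := DA _ DB.
move: Bx; rewrite -{}FB /= => Fx.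
suff [n nF] : exists n, forall C, C \in F -> prefix_cylinder x n `<=` C.
  by exists n => y ny C /nF; apply.
have cF C : C \in F -> exists n, prefix_cylinder x n `<=` C.
  move=> CF; have := Fx _ CF; have := Fc _ CF.
  rewrite inE => -[m [i [p ->]]]; have [y [k [_ _ ->]]] := cylinderE p.
  by move=> /prefix_cylinder_eq <-; exists k.
exact: (common_cylinder (s := enum_fset F)) cF.
Qed.

Lemma measurable_prefix_cylinder x n :
  measurable (prefix_cylinder x n : set borel_path_space).
Proof. by apply: sub_sigma_algebra; exact: open_prefix_cylinder. Qed.

(** These paths are countably many and meet every cylinder; they serve as the
    index set of all countable unions over cylinders. *)
Definition dense_path (s : seq nat) : path_space := path_of (nth 0%N s).

Lemma dense_path_prefix x n :
  exists s, prefix_cylinder x n (dense_path s).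
Proof.
exists (mkseq (vertex x) n.+1); apply: vertex_path_of_prefix => k kn.
by rewrite nth_mkseq.
Qed.

Lemma cylinder_cover (A : set path_space) n :
  (forall x y, prefix_cylinder x n y -> A x -> A y) ->
  A = \bigcup_(s in [set s | A (dense_path s)]) prefix_cylinder (dense_path s) n.
Proof.
move=> An; apply/seteqP; split=> [x Ax|x [s /= As sx]]; last exact: An As.
have [s xs] := dense_path_prefix x n; exists s; first exact: An Ax.
by rewrite /= (prefix_cylinder_eq xs).
Qed.

(** A set depending on finitely many vertices is a countable union of
    cylinders. *)
Lemma measurable_local (A : set borel_path_space) n :
  (forall x y, prefix_cylinder x n y -> A x -> A y) -> measurable A.
Proof.
move=> /cylinder_cover ->; rewrite bigcup_mkcond.
apply: countable_bigcupT_measurable => // s.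
by case: ifP => // _; exact: measurable_prefix_cylinder.
Qed.

Lemma bigcup_unpickle T (I : countType) (F : I -> set T) :
  \bigcup_i F i = \bigcup_k oapp F set0 (choice.unpickle k).
Proof.
apply/seteqP; split=> [x [i _ Fi]|x [k _]].
  by exists (choice.pickle i) => //; rewrite choice.pickleK.
by case: choice.unpickle => //= i Fi; exists i.
Qed.

Lemma bigcup_dense_cylinders n :
  \bigcup_s prefix_cylinder (dense_path s) n = setT.
Proof.
rewrite -subTset => x _; have [s xs] := dense_path_prefix x n.
by exists s => //; rewrite (prefix_cylinder_eq xs).
Qed.

(** Cylinders with more than n vertices already generate the Borel sets; checking
    an equality of measures on them only is what makes the exchange of
    prefixes with n + 1 vertices tractable. The empty set is added for stability under
    intersection. *)
Definition deep_cylinders n : set (set path_space) :=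
  [set A | A = set0 \/ exists x k, (n <= k)%N /\ A = prefix_cylinder x k].

Lemma borel_deep_cylinders n :
  @measurable _ borel_path_space = <<s deep_cylinders n >>.
Proof.
apply/seteqP; split; last first.
  apply: smallest_sub; first exact: smallest_sigma_algebra.
  by move=> _ [->|[x [k [_ ->]]]] //; exact: measurable_prefix_cylinder.
apply: smallest_sub; first exact: smallest_sigma_algebra.
move=> A oA; pose G := g_sigma_algebraType (deep_cylinders n).
pose U (i : seq nat * nat) : set G := if `[< prefix_cylinder (dense_path i.1) (n + i.2)
   `<=` A >] then prefix_cylinder (dense_path i.1) (n + i.2) else set0.
rewrite (_ : A = \bigcup_i U i).
  apply: (@countable_bigcupT_measurable _ G) => // i; rewrite /U.
  case: ifP => _ //; apply: sub_sigma_algebra; right.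
  by exists (dense_path i.1), (n + i.2)%N; rewrite leq_addr.
apply/seteqP; split=> [x Ax|x [i _]]; last first.
  by rewrite /U; case: asboolP => // h /h.
have [m mA] := open_sub_cylinder oA Ax.
have [s xs] := dense_path_prefix x (n + m).
exists (s, m) => //; rewrite /U/= (prefix_cylinder_eq xs); case: asboolP => // -[].
by move=> z /(prefix_cylinder_le (leq_addl n m))/mA.
Qed.

Lemma deep_cylindersI n : setI_closed (deep_cylinders n).
Proof.
move=> A B [->|[x [j [nj ->]]]]; first by rewrite set0I; left.
move=> [->|[y [k [nk ->]]]]; first by rewrite setI0; left.
wlog jk : x y j k nj nk / (j <= k)%N.
  move=> wl; have [jk|kj] := leqP j k; first exact: wl.
  by rewrite setIC; apply: wl => //; exact: ltnW.
rewrite prefix_cylinderI//; case: asboolP => _; last by left.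
by right; exists y, k.
Qed.

Lemma measure_cylinder_unique {R : realType} n
    (m1 m2 : {measure set borel_path_space -> \bar R}) :
  (m1 setT < +oo)%E ->
  (forall x k, (n <= k)%N -> m1 (prefix_cylinder x k) = m2 (prefix_cylinder x k)) ->
  forall A, measurable A -> m1 A = m2 A.
Proof.
move=> m1oo m12 A; rewrite (borel_deep_cylinders n) => mA.
pose g k : set borel_path_space :=
  oapp (fun s => prefix_cylinder (dense_path s) n) set0 (choice.unpickle k).
have mg k : measurable (g k).
  rewrite /g; case: choice.unpickle => [s|] /=; last exact: measurable0.
  exact: measurable_prefix_cylinder.
apply: (@g_sigma_algebra_measure_unique _ R borel_path_space
  (deep_cylinders n) _ g) => //.
- by rewrite (borel_deep_cylinders n); exact: sub_sigma_algebra.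
- rewrite /g => k; case: choice.unpickle => [s|]; last by left.
  by right; exists (dense_path s), n.
- by rewrite -bigcup_unpickle bigcup_dense_cylinders.
- exact: deep_cylindersI.
- by move=> B [->|[x [k [nk ->]]]]; [rewrite !measure0|exact: m12].
- by move=> k; apply: le_lt_trans m1oo; apply: le_measure; rewrite ?inE.
Qed.

Lemma measurable_local_fun (f : borel_path_space -> borel_path_space) (b : nat -> nat) :
  (forall n x y, prefix_cylinder x (b n) y -> prefix_cylinder (f x) n (f y)) ->
  measurable_fun setT f.
Proof.
move=> fb; apply: (@measurability _ _ borel_path_space borel_path_space _ _
  (deep_cylinders 0)); first exact: borel_deep_cylinders.
move=> _ [_ [->|[x [k [_ ->]]]] <-]; first by rewrite preimage_set0 setI0.
rewrite setTI; apply: (@measurable_local _ (b k)) => y z yz /= yx j jk.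
by rewrite (fb k y z)// yx.
Qed.

(** * Comparison of finite measures *)

Section measures.
Context d d' (T : measurableType d) (T' : measurableType d') (R : realType).
Implicit Types m : {measure set T -> \bar R}.
Local Open Scope ereal_scope.

(** The existential form hides the measurability proofs on which the bundled
    image measure depends. *)
Lemma restricted_image_measure m (D : set T) (f : T -> T') :
  measurable D -> measurable_fun setT f ->
  exists m' : {measure set T' -> \bar R},
    forall A, m' A = m (D `&` f @^-1` A).
Proof.
move=> mD mf.
exists (measure_function_pushforward__canonical__measure_function_Measure
  (mrestr m mD) mf).
by move=> A; rewrite /= /pushforward /= /mrestr setIC.
Qed.

Lemma measure_lty m A : m setT < +oo -> measurable A -> m A < +oo.
Proof. by move=> moo mA; apply: le_lt_trans moo; apply: le_measure; rewrite ?inE. Qed.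

Lemma measure_split m (A B : set T) : measurable A -> measurable B ->
  m A = m (A `&` B) + m (A `\` B).
Proof.
move=> mA mB; rewrite -measureU.
- by rewrite setUIDK.
- exact: measurableI.
- exact: measurableD.
- by rewrite setDE setIACA setICr setI0.
Qed.

Lemma measure_le_eq m1 m2 : m2 setT < +oo -> m1 setT = m2 setT ->
  (forall A, measurable A -> m1 A <= m2 A) ->
  forall A, measurable A -> m1 A = m2 A.
Proof.
move=> oo2 eT le12 A mA; have mCA := measurableC mA.
apply/eqP; rewrite eq_le le12//=; move: eT.
have E m : m setT = m A + m (~` A).
  by rewrite (measure_split m measurableT mA) setTI setTD.
rewrite !E => eT.
have fC : m1 (~` A) \is a fin_num.
  rewrite ge0_fin_numE//; apply: le_lt_trans (le12 _ mCA) _.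
  exact: measure_lty.
by rewrite -(leeD2rE _ _ fC) eT leeD2l// le12.
Qed.

(** For m1 = m and m2 = c nu this says that P is a positive set of the charge
    m - c nu, without any subtraction. *)
Definition dominates_on m1 m2 (P : set T) :=
  forall A, measurable A -> A `<=` P -> m2 A <= m1 A.

(** Disjointify the union and add the inequalities: positive sets are stable
    under countable unions. *)
Lemma dominates_on_bigcup m1 m2 (I : countType) (F : I -> set T) :
  (forall i, measurable (F i)) -> (forall i, dominates_on m1 m2 (F i)) ->
  dominates_on m1 m2 (\bigcup_i F i).
Proof.
move=> mF dF; rewrite bigcup_unpickle; set P := fun k => oapp _ _ _.
have mP k : measurable (P k).
  by rewrite /P; case: choice.unpickle => //=; exact: measurable0.
have dP k : dominates_on m1 m2 (P k).
  rewrite /P; case: choice.unpickle => //= A _.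
  by rewrite subset0 => ->; rewrite !measure0.
move=> A mA AP.
have mQ k : measurable (A `&` seqDU P k).
  by apply: measurableI => //; apply: measurableD => //; exact: bigsetU_measurable.
have tQ : trivIset setT (fun k => A `&` seqDU P k).
  by apply: trivIset_setIl; exact: trivIset_seqDU.
rewrite (_ : A = \bigcup_k (A `&` seqDU P k)); last first.
  by rewrite -setI_bigcupr -seqDU_bigcup_eq setIidl.
have E m : m (\bigcup_k (A `&` seqDU P k)) = \sum_(k <oo) m (A `&` seqDU P k).
  by apply: measure_semi_bigcup => //; exact: bigcupT_measurable.
rewrite !E.
apply: lee_nneseries => [k _ _|k _]; first exact: measure_ge0.
by apply: (dP k) => // x [_ []].
Qed.

Lemma hahn_measures m1 m2 : m1 setT < +oo -> m2 setT < +oo ->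
  exists P, [/\ measurable P, dominates_on m1 m2 P & dominates_on m2 m1 (~` P)].
Proof.
move=> oo1 oo2.
have f2 A : measurable A -> m2 A \is a fin_num.
  by move=> mA; rewrite ge0_fin_numE//; exact: measure_lty.
pose n1 := mfrestr measurableT oo1; pose n2 := mfrestr measurableT oo2.
pose nu := cadd (charge_of_finite_measure n1)
  (copp (charge_of_finite_measure n2)).
have nuE A : nu A = m1 A - m2 A.
  by transitivity (m1 (A `&` setT) - m2 (A `&` setT)) => //; rewrite setIT.
have [P [N [[mP posP] [mN negN] PN PN0]]] := Hahn_decomposition nu.
exists P; split => // A mA AP.
  by rewrite -sube_ge0 ?f2// -nuE; exact: posP.
have AN : A `<=` N.
  by move=> x Ax; have : (P `|` N) x; [rewrite PN|case=> // /(AP _ Ax)].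
by rewrite -sube_le0 -nuE; exact: negN.
Qed.

End measures.

(** * Exchange of prefixes and extremality of ergodic measures *)

Section splice.

(** Replaces the first n + 1 vertices of y by those of x when both prefixes end at
    the same vertex, and leaves y unchanged otherwise. These maps generate tail
    equivalence. *)
Definition splice (x : path_space) (n : nat) (y : path_space) : path_space :=
  if vertex x n == vertex y n
  then path_of (fun k => if (k <= n)%N then vertex x k else vertex y k) else y.

Lemma vertex_splice x n y k : vertex x n = vertex y n ->
  vertex (splice x n y) k = if (k <= n)%N then vertex x k else vertex y k.
Proof.
move=> xy; rewrite /splice xy eqxx vertex_path_of ?vertex_gt0// => j _.
case: (leqP j.+1 n) => [jn|]; first by rewrite (ltnW jn) vertexS.
rewrite ltnS leq_eqVlt => /predU1P[<-|nj]; first by rewrite leqnn xy vertexS.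
by rewrite (leqNgt j n) nj vertexS.
Qed.

Lemma splice_prefix x n x' y : prefix_cylinder x n x' ->
  splice x' n y = splice x n y.
Proof.
move=> xx'; rewrite /splice xx'//; case: eqP => // _; congr path_of.
by apply/funext => k; case: ifP => // /xx'.
Qed.

Lemma tail_equivalent_refl x : tail_equivalent x x.
Proof. by exists 0%N. Qed.

Lemma tail_equivalent_sym x y : tail_equivalent x y -> tail_equivalent y x.
Proof. by move=> [N xy]; exists N => k /xy. Qed.

Lemma tail_equivalent_trans y x z :
  tail_equivalent x y -> tail_equivalent y z -> tail_equivalent x z.
Proof.
move=> [M xy] [N yz]; exists (maxn M N) => k; rewrite geq_max => /andP[Mk Nk].
by rewrite xy// yz.
Qed.

Lemma splice_tail_equivalent x n y : tail_equivalent (splice x n y) y.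
Proof.
have [xy|xy] := eqVneq (vertex x n) (vertex y n); last first.
  by rewrite /splice (negbTE xy); exact: tail_equivalent_refl.
exists n.+1 => k nk; apply: edge_vertex_ext; rewrite vertex_splice//.
  by rewrite (leqNgt k n) nk.
by rewrite (leqNgt k.+1 n) ltnS (ltnW nk).
Qed.

Lemma tail_equivalent_splice x y : tail_equivalent x y ->
  exists N, vertex x N = vertex y N /\ x = splice x N y.
Proof.
move=> [N xy]; exists N; have xyN : vertex x N = vertex y N by rewrite /vertex xy.
split=> //; apply: path_ext => k; rewrite vertex_splice//; case: leqP => // Nk.
by rewrite /vertex xy// ltnW.
Qed.

Lemma measurable_splice x n :
  measurable_fun setT (splice x n : borel_path_space -> borel_path_space).
Proof.
apply: (@measurable_local_fun _ (maxn n)) => k y z yz j jk.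
have yzn : vertex z n = vertex y n by apply: yz; exact: leq_maxl.
have yzj : vertex z j = vertex y j.
  by apply: yz; rewrite leq_max jk orbT.
have [xy|xy] := eqVneq (vertex x n) (vertex y n).
  by rewrite !vertex_splice ?yzn// yzj.
by rewrite /splice yzn (negbTE xy) yzj.
Qed.

Definition tail_saturation (A : set path_space) : set path_space :=
  [set y | exists2 x, tail_equivalent x y & A x].

Lemma tail_saturation_saturated A : tail_saturated (tail_saturation A).
Proof.
move=> x y xy [z zx Az]; exists z => //; exact: tail_equivalent_trans xy.
Qed.

Lemma sub_tail_saturation A : A `<=` tail_saturation A.
Proof. by move=> x Ax; exists x => //; exact: tail_equivalent_refl. Qed.

(** Since [splice x n] depends on a prefix of x only, countably many x suffice;
    this is why saturations of Borel sets are Borel. *)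
Lemma tail_saturationE A : tail_saturation A =
  \bigcup_(i : seq nat * nat) (splice (dense_path i.1) i.2 @^-1` A).
Proof.
apply/seteqP; split=> [y [x /tail_equivalent_splice[N [_ ->]] Ax]|y [[s n] _]].
  have [s xs] := dense_path_prefix x N.
  by exists (s, N) => //=; rewrite (splice_prefix _ xs).
by move=> /= h; exists (splice (dense_path s) n y) => //;
  exact: splice_tail_equivalent.
Qed.

End splice.

Section invariance.
Context {R : realType}.
Implicit Types m : {measure set borel_path_space -> \bar R}.
Local Open Scope ereal_scope.

Definition cylinder_invariant m := forall x y n, vertex x n = vertex y n ->
  m (prefix_cylinder x n) = m (prefix_cylinder y n).

(** The instance of [restricted_image_measure] for self-maps of the path space,
    with the types in the form in which the masses of cylinders are written. *)
Lemma path_image_measure m (D : set borel_path_space)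
    (f : borel_path_space -> borel_path_space) :
  measurable D -> measurable_fun setT f ->
  exists m' : {measure set borel_path_space -> \bar R},
    forall A, m' A = m (D `&` f @^-1` A).
Proof. exact: restricted_image_measure. Qed.

(** Exchanging two prefixes with the same final vertex preserves a tail
    invariant measure: it maps each cylinder longer than the prefixes onto a
    cylinder with the same length and final vertex. *)
Lemma splice_invariant m x y n (B : set borel_path_space) :
  m setT < +oo -> cylinder_invariant m ->
  vertex x n = vertex y n -> measurable B ->
  m (prefix_cylinder y n `&` B) =
  m (prefix_cylinder x n `&` splice y n @^-1` B).
Proof.
move=> moo minv xy mB.
have mid : measurable_fun setT (id : borel_path_space -> borel_path_space) by [].
have [m1 m1E] := path_image_measure m (measurable_prefix_cylinder y n) mid.
have [m2 m2E] := path_image_measure m (measurable_prefix_cylinder x n)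
  (measurable_splice y n).
rewrite -m2E -[LHS]m1E; apply: (measure_cylinder_unique (n := n)) mB => [|z k nk].
  rewrite m1E preimage_id setIT; apply: (measure_lty moo).
  exact: measurable_prefix_cylinder.
rewrite m1E m2E preimage_id prefix_cylinderI//; case: asboolP => yz; last first.
  rewrite (_ : _ `&` _ = set0)//; apply/seteqP; split=> // w [/= xw sw].
  apply: yz => j jn; rewrite -sw ?(leq_trans jn)// vertex_splice ?jn//.
  by rewrite -xy -xw.
have yxn : vertex z n = vertex x n by rewrite yz.
rewrite (_ : _ `&` _ = prefix_cylinder (splice x n z) k).
  apply: minv; rewrite vertex_splice; last by rewrite yz.
  case: leqP => // kn; rewrite (_ : k = n)//.
  by apply/eqP; rewrite eqn_leq kn.
apply/seteqP; split=> w /=.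
  move=> [xw sw] j jk; rewrite vertex_splice//; case: leqP => jn; first exact: xw.
  rewrite -(sw j)// vertex_splice; first by rewrite (leqNgt j n) jn.
  by rewrite xw.
move=> sw; have xw : prefix_cylinder x n w.
  by move=> j jn; rewrite sw ?(leq_trans jn)// vertex_splice// jn.
split=> // j jk; rewrite vertex_splice; last by rewrite xw.
by case: leqP => jn; [rewrite yz|rewrite sw// vertex_splice// (leqNgt j n) jn].
Qed.

(** The map [splice x n] is not injective, so the set is first cut along the
    cylinders of length n + 1; on each of them the map is an exchange of
    prefixes, which changes neither measure. *)
Lemma dominates_on_splice m1 m2 (P : set borel_path_space) x n : measurable P ->
  m1 setT < +oo -> m2 setT < +oo ->
  cylinder_invariant m1 -> cylinder_invariant m2 ->
  dominates_on m1 m2 P -> dominates_on m1 m2 (splice x n @^-1` P).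
Proof.
move=> mP oo1 oo2 inv1 inv2 dP.
have mspl z (A : set borel_path_space) : measurable A ->
    measurable (splice z n @^-1` A : set borel_path_space).
  by move=> mA; rewrite -[X in measurable X]setTI; apply: measurable_splice.
have -> : splice x n @^-1` P =
    \bigcup_s (splice x n @^-1` P `&` prefix_cylinder (dense_path s) n).
  by rewrite -setI_bigcupr bigcup_dense_cylinders setIT.
apply: dominates_on_bigcup => [s|s A mA].
  apply: measurableI; first exact: mspl.
  exact: measurable_prefix_cylinder.
set y := dense_path s => AU.
have [xy|xy] := eqVneq (vertex x n) (vertex y n); last first.
  (* off the cylinders ending at the same vertex as x, the map is the identity *)
  apply: dP => // z /[dup] Az /AU [/=].
  by rewrite /splice => + yz; rewrite yz// (negbTE xy).
have Ay : A = prefix_cylinder y n `&` A.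
  by apply/seteqP; split=> [z Az|z []//]; split => //; have [] := AU _ Az.
rewrite Ay !(splice_invariant _ _ xy)//; apply: dP.
  by apply: measurableI; [exact: measurable_prefix_cylinder|exact: mspl].
move=> z [xz /= /AU [/= + _]].
(* replacing the prefix of z by that of y and back by that of x returns z *)
rewrite (_ : splice _ _ _ = z)//; apply: path_ext => j.
rewrite vertex_splice.
  rewrite vertex_splice; last by rewrite xz.
  by case: leqP => // /xz.
by rewrite vertex_splice ?leqnn// xz.
Qed.

Lemma dominates_on_saturation m1 m2 (P : set borel_path_space) : measurable P ->
  m1 setT < +oo -> m2 setT < +oo ->
  cylinder_invariant m1 -> cylinder_invariant m2 ->
  dominates_on m1 m2 P ->
  measurable (tail_saturation P : set borel_path_space) /\
  dominates_on m1 m2 (tail_saturation P).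
Proof.
move=> mP oo1 oo2 inv1 inv2 dP; rewrite tail_saturationE.
have mspl s n : measurable (splice (dense_path s) n @^-1` P : set borel_path_space).
  by rewrite -[X in measurable X]setTI; apply: measurable_splice.
split; first exact: countable_bigcupT_measurable.
by apply: dominates_on_bigcup => // i; exact: dominates_on_splice.
Qed.

(** Let P be a Hahn set of m against m(X) nu, replaced by its saturation.
    By ergodicity P or its complement is null for nu, hence for m; so one of
    m and m(X) nu is below the other. As their total masses agree, they are
    equal. *)
Lemma ergodic_extremal (nu : probability borel_path_space R) m :
  ergodic nu -> cylinder_invariant nu -> cylinder_invariant m ->
  (forall A, measurable A -> m A <= nu A) ->
  forall A, measurable A -> m A = m setT * nu A.
Proof.
move=> erg nuinv minv mnu.
have nuoo : nu setT < +oo by rewrite probability_setT ltry.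
have moo : m setT < +oo by apply: le_lt_trans (mnu _ _) nuoo.
have mfin : m setT \is a fin_num by rewrite ge0_fin_numE.
have c0 : (0 <= fine (m setT))%R by exact: fine_ge0.
pose m2 : {measure set borel_path_space -> \bar R} := mscale (NngNum c0) nu.
have m2E A : m2 A = m setT * nu A by rewrite -[in RHS](fineK mfin).
have m2T : m2 setT = m setT by rewrite m2E probability_setT mule1.
have m2inv : cylinder_invariant m2 by move=> x y n xy; rewrite !m2E (nuinv x y).
have m2oo : m2 setT < +oo by rewrite m2T.
have [P [mP dP dN]] := hahn_measures moo m2oo.
have [mS dS] := dominates_on_saturation mP moo m2oo minv m2inv dP.
set S := tail_saturation P in mS dS.
have dN' : dominates_on m2 m (~` S).
  by move=> A mA AS; apply: dN => // x /AS nS Px; apply: nS; exact: sub_tail_saturation.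
have mI A B : measurable A -> measurable B -> nu B = 0 -> m (A `&` B) = 0.
  move=> mA mB B0; apply/eqP; rewrite eq_le measure_ge0 andbT -B0.
  apply: le_trans (mnu _ _) _; first exact: measurableI.
  by apply: le_measure; rewrite ?inE//; exact: measurableI.
have nI A B : measurable A -> measurable B -> nu B = 0 -> nu (A `&` B) = 0.
  move=> mA mB B0; apply/eqP; rewrite eq_le measure_ge0 andbT -B0.
  by apply: le_measure; rewrite ?inE//; exact: measurableI.
move=> A mA; rewrite -m2E.
have [S0|S1] := erg S mS (@tail_saturation_saturated P).
  apply: measure_le_eq mA => // B mB.
  rewrite (measure_split m mB mS) mI// add0e.
  apply: (@le_trans _ _ (m2 (B `\` S))).
    by apply: dN' => [|x []//]; exact: measurableD.
  by apply: le_measure; rewrite ?inE//; exact: measurableD.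
have CS0 : nu (~` S) = 0 by rewrite probability_setC// S1 subee.
apply/esym; apply: measure_le_eq mA => // B mB.
have mCS := measurableC mS.
rewrite (measure_split m2 mB mCS) [X in X + _]m2E nI// mule0 add0e.
rewrite setDE setCK.
apply: (@le_trans _ _ (m (B `&` S))).
  by apply: dS => [|x []//]; exact: measurableI.
by apply: le_measure; rewrite ?inE//; exact: measurableI.
Qed.

End invariance.

(** * Cylinder masses of ergodic measures *)

Lemma trivIset_fibers T (I : eqType) (A : set T) (f : T -> I) :
  trivIset setT (fun i => A `&` [set x | f x = i]).
Proof. by move=> i j _ _ [x [[_ /= <-] [_ /= <-]]]. Qed.

Section harmonic.
Context {R : realType}.
Implicit Types m : {measure set borel_path_space -> \bar R}.
Local Open Scope ereal_scope.

Lemma measurable_vertex_set k (P : set nat) :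
  measurable ([set x | P (vertex x k)] : set borel_path_space).
Proof. by apply: (@measurable_local _ k) => x y xy /=; rewrite xy. Qed.

Lemma measure_fibers m (A : set borel_path_space) k : measurable A ->
  m A = \sum_(j <oo) m (A `&` [set x | vertex x k = j]).
Proof.
move=> mA.
rewrite {1}(_ : A = \bigcup_j (A `&` [set x | vertex x k = j])).
  rewrite measure_semi_bigcup//.
  - by move=> j; apply: measurableI => //; exact: (measurable_vertex_set k [set j]).
  - exact: trivIset_fibers.
  - apply: bigcupT_measurable => j.
    by apply: measurableI => //; exact: (measurable_vertex_set k [set j]).
apply/seteqP; split=> [x Ax|x [j _ []//]].
by exists (vertex x k).
Qed.

Definition cylinder_mass m n i := m (prefix_cylinder (const_path i) n).

Lemma cylinder_massE m x n : cylinder_invariant m ->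
  m (prefix_cylinder x n) = cylinder_mass m n (vertex x n).
Proof. by apply; rewrite vertex_const_path ?vertex_gt0. Qed.

Lemma cylinder_mass_step m n i j : cylinder_invariant m -> (0 < i)%N ->
  m (prefix_cylinder (const_path i) n `&` [set y | vertex y n.+1 = j]) =
  if (i <= j)%N then cylinder_mass m n.+1 j else 0.
Proof.
move=> minv i0; case: leqP => ij; last first.
  rewrite (_ : _ `&` _ = set0)//; apply/seteqP; split=> // y [/= yi yj].
  move: ij; rewrite -yj ltnNge -[X in (X <= _)%N](vertex_const_path n i0) -yi//.
  by rewrite vertexS.
pose x := path_of (fun k => if (k <= n)%N then i else j).
have xE k : vertex x k = if (k <= n)%N then i else j.
  rewrite vertex_path_of// => l _.
  case: (leqP l.+1 n) => [ln|_]; first by rewrite (ltnW ln).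
  by case: (leqP l n).
rewrite (_ : _ `&` _ = prefix_cylinder x n.+1).
  by rewrite cylinder_massE// xE ltnn.
apply/seteqP; split=> y /=.
  move=> [yi yj] k; rewrite xE; case: (leqP k n) => kn kn1.
    by rewrite yi// vertex_const_path.
  by rewrite (_ : k = n.+1)//; apply/eqP; rewrite eqn_leq kn1.
move=> yx; split; last by rewrite yx// xE ltnn.
by move=> k kn; rewrite yx ?leqW// xE kn vertex_const_path.
Qed.

(** Continue a cylinder ending at i by its next vertex j >= i. The
    continuations with j > i have the same masses as those of a cylinder
    ending at i + 1, and the one with j = i is a cylinder one step longer. *)
Lemma cylinder_mass_harmonic m n i : cylinder_invariant m -> (0 < i)%N ->
  cylinder_mass m n i = cylinder_mass m n i.+1 + cylinder_mass m n.+1 i.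
Proof.
move=> minv i0.
have mC := measurable_prefix_cylinder (const_path i) n.
have mV : measurable ([set y | vertex y n.+1 = i] : set borel_path_space).
  exact: (measurable_vertex_set n.+1 [set i]).
rewrite {1}/cylinder_mass (measure_split m mC mV) cylinder_mass_step// leqnn addeC.
congr (_ + _).
rewrite (measure_fibers m n.+1 (measurableD mC mV)) /cylinder_mass.
rewrite [RHS](measure_fibers m n.+1); last exact: measurable_prefix_cylinder.
apply: eq_eseriesr => j _; rewrite cylinder_mass_step//.
have [->|ji] := eqVneq j i.
  by rewrite ltnn (_ : _ `&` _ = set0) ?measure0//; apply/seteqP; split=> // y [[]].
rewrite setDE -setIA (_ : ~` _ `&` _ = [set y | vertex y n.+1 = j]).
  by rewrite cylinder_mass_step// leq_eqVlt eq_sym (negbTE ji).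
by apply/seteqP; split=> y /= => [[]//|yj]; split=> //; rewrite yj; exact/eqP.
Qed.

End harmonic.

Section lower_shift.

Definition lower (x : path_space) : path_space :=
  path_of (fun k => (vertex x k).-1).

Definition raise (x : path_space) : path_space :=
  path_of (fun k => (vertex x k).+1).

Definition shift (x : path_space) : path_space :=
  @InfinitePath (fun k => x k.+1) (fun k => edgesP x k.+1).

Definition unshift (x : path_space) : path_space :=
  path_of (fun k => if k is k'.+1 then vertex x k' else 1%N).

Lemma vertex_shift x k : vertex (shift x) k = vertex x k.+1.
Proof. by []. Qed.

Lemma vertex_lower x k : (1 < vertex x 0)%N ->
  vertex (lower x) k = (vertex x k).-1.
Proof.
move=> x0; rewrite vertex_path_of; first by [].
  by rewrite -subn1 subn_gt0.
by move=> j _; rewrite -!subn1 leq_sub2r// vertexS.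
Qed.

Lemma vertex_raise x k : vertex (raise x) k = (vertex x k).+1.
Proof. by rewrite vertex_path_of// => j _; rewrite ltnS vertexS. Qed.

Lemma vertex_unshift x k :
  vertex (unshift x) k = if k is k'.+1 then vertex x k' else 1%N.
Proof. by rewrite vertex_path_of// => -[|j] _; [exact: vertex_gt0|exact: vertexS]. Qed.

Lemma measurable_lower :
  measurable_fun setT (lower : borel_path_space -> borel_path_space).
Proof.
apply: (@measurable_local_fun _ id) => n x y xy k kn.
have lE v w : (forall j, (j <= n)%N -> v j = w j) ->
    running_max v k = running_max w k.
  elim: k kn => [|k IH] kn vw /=; first by rewrite vw.
  by rewrite IH ?vw// ltnW.
by apply: lE => j jn; rewrite xy.
Qed.

Lemma measurable_shift :
  measurable_fun setT (shift : borel_path_space -> borel_path_space).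
Proof.
by apply: (@measurable_local_fun _ succn) => n x y xy k kn; rewrite !vertex_shift xy.
Qed.

(** Thus the image of nu under [lower], restricted to the paths starting
    above 1, gives to a cylinder ending at i the mass of one ending at i + 1. *)
Lemma lower_cylinder x n :
  [set y | (1 < vertex y 0)%N] `&` lower @^-1` prefix_cylinder x n =
  prefix_cylinder (raise x) n.
Proof.
apply/seteqP; split=> y /=.
  move=> [y0 yx] k kn; rewrite vertex_raise -yx// vertex_lower// prednK//.
  exact: vertex_gt0.
move=> yx; have y0 : (1 < vertex y 0)%N by rewrite yx// vertex_raise ltnS vertex_gt0.
by split=> // k kn; rewrite vertex_lower// yx// vertex_raise.
Qed.

(** Thus the image of nu under [shift], restricted to the paths starting at 1,
    gives to a cylinder the mass of one with the same end and one more vertex. *)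
Lemma shift_cylinder x n :
  [set y | vertex y 0 = 1%N] `&` shift @^-1` prefix_cylinder x n =
  prefix_cylinder (unshift x) n.+1.
Proof.
apply/seteqP; split=> y /=.
  move=> [y0 yx] [|k] kn; rewrite vertex_unshift//.
  by rewrite -yx.
move=> yx; split; first by rewrite yx// vertex_unshift.
by move=> k kn; rewrite vertex_shift yx// vertex_unshift.
Qed.

End lower_shift.

Section ergodic_mass.
Context {R : realType}.
Local Open Scope ereal_scope.

(** By [cylinder_mass_harmonic] nu is the sum of its images under [lower] and
    [shift]. The first is tail invariant and dominated by nu, hence equal to
    c nu, where c is the mass of the paths starting above 1. *)
Lemma ergodic_cylinder_mass (nu : probability borel_path_space R) :
  cylinder_invariant nu -> ergodic nu ->
  exists2 c : R, (0 <= c <= 1)%R & forall n i, (0 < i)%N ->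
    cylinder_mass nu n i = (c ^+ i.-1 * (1 - c) ^+ n.+1)%:E.
Proof.
move=> nuinv erg.
have nuoo : nu setT < +oo by rewrite probability_setT ltry.
have mD1 := measurable_vertex_set 0 [set j | (1 < j)%N].
have mD2 := measurable_vertex_set 0 [set 1%N].
have [nu1 nu1E] := path_image_measure nu mD1 measurable_lower.
have [nu2 nu2E] := path_image_measure nu mD2 measurable_shift.
have nu1C x n : nu1 (prefix_cylinder x n) = cylinder_mass nu n (vertex x n).+1.
  by rewrite nu1E [_ `&` _]lower_cylinder cylinder_massE// vertex_raise.
have nu2C x n : nu2 (prefix_cylinder x n) = cylinder_mass nu n.+1 (vertex x n).
  by rewrite nu2E [_ `&` _]shift_cylinder cylinder_massE// vertex_unshift.
have nu1T : nu1 setT = nu [set y | (1 < vertex y 0)%N].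
  by rewrite nu1E preimage_setT setIT.
have nu12 A : measurable A -> nu A = nu1 A + nu2 A.
  rewrite -(measure_addE nu1 nu2 A).
  apply: (measure_cylinder_unique (n := 0)) => // x n _.
  rewrite [RHS]measure_addE nu1C nu2C cylinder_massE//.
  by rewrite cylinder_mass_harmonic// vertex_gt0.
have nu1inv : cylinder_invariant nu1.
  by move=> x y n xy; rewrite !nu1C xy.
have nu1le A : measurable A -> nu1 A <= nu A.
  by move=> mA; rewrite nu12// leeDl.
have nu1M := ergodic_extremal erg nuinv nu1inv nu1le.
have c1 : nu1 setT <= 1 by rewrite nu1T; exact: probability_le1.
have fin1 : nu1 setT \is a fin_num.
  by rewrite ge0_fin_numE// (le_lt_trans c1)// ltry.
exists (fine (nu1 setT)).
  by rewrite fine_ge0//= -lee_fin fineK.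
set c := fine _; have cE : nu1 setT = c%:E by rewrite fineK.
have finm n i : cylinder_mass nu n i \is a fin_num.
  by apply: fin_num_measure; exact: measurable_prefix_cylinder.
have massS n i : (0 < i)%N -> cylinder_mass nu n i.+1 = c%:E * cylinder_mass nu n i.
  move=> i0; have := nu1C (const_path i) n; rewrite vertex_const_path// => <-.
  by rewrite nu1M ?cE//; exact: measurable_prefix_cylinder.
have massN n i : (0 < i)%N ->
    cylinder_mass nu n.+1 i = (1 - c)%:E * cylinder_mass nu n i.
  move=> i0; have := cylinder_mass_harmonic n nuinv i0; rewrite massS//.
  move: (finm n i) (finm n.+1 i).
  case: (cylinder_mass nu n i) (cylinder_mass nu n.+1 i) => [a||] [b||] //= _ _.
  by rewrite -!EFinM -EFinD => -[ab]; congr EFin; move: ab; lra.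
have mass01 : cylinder_mass nu 0 1 = (1 - c)%:E.
  rewrite /cylinder_mass (_ : prefix_cylinder _ _ = ~` [set y | (1 < vertex y 0)%N]).
    by rewrite [LHS](probability_setC nu mD1) EFinB -cE nu1T.
  apply/seteqP; split=> y /=.
    by move=> /(_ 0%N isT) ->; rewrite vertex_const_path.
  move=> y1 k; rewrite leqn0 => /eqP->; rewrite vertex_const_path//.
  by apply/eqP; rewrite eqn_leq vertex_gt0 andbT leqNgt; apply/negP.
move=> n [//|i] _; rewrite -pred_Sn; elim: i => [|i IH].
  elim: n => [|n IH]; first by rewrite mass01 expr0 expr1 mul1r.
  by rewrite massN// IH -EFinM; congr EFin; rewrite (exprS _ n.+1); ring.
by rewrite massS// IH -EFinM; congr EFin; rewrite (exprS _ i); ring.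
Qed.

End ergodic_mass.

(** * Geometric measures are ergodic and non-atomic *)

Section bounded_harmonic.
Context {R : realType}.
Variable c : R.
Hypotheses (c0 : 0 < c) (c1 : c < 1).
Implicit Types h : nat -> nat -> R.

Definition harmonic h := forall n s, h n s = c * h n s.+1 + (1 - c) * h n.+1 s.

(** The increment D(n, s) = h(n, s+1) - h(n, s) is again harmonic. If its
    supremum M were positive, a point where D nearly reaches M would force D
    to be nearly M along a long segment of the s-axis, as an average cannot
    exceed M; summing D along that segment makes h unbounded. *)
Lemma bounded_harmonic_nonincreasing h : harmonic h ->
  (forall n s, `|h n s| <= 1) -> forall n s, h n s.+1 <= h n s.
Proof.
move=> hh hb n s; rewrite leNgt; apply/negP => hlt.
pose D n s := h n s.+1 - h n s.
have Dh n' s' : D n' s' = c * D n' s'.+1 + (1 - c) * D n'.+1 s'.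
  by rewrite /D (hh n' s') (hh n' s'.+1); ring.
have hb' n' s' : -1 <= h n' s' <= 1 by rewrite -ler_norml.
pose S := [set D i.1 i.2 | i in [set: nat * nat]].
have ubS : ubound S 2.
  move=> _ [[n' s'] _ <-]; rewrite /D /=.
  by have := hb' n' s'; have := hb' n' s'.+1; lra.
have supS : has_sup S by split; [exists (D 0%N 0%N), (0%N, 0%N)|exists 2].
set M := sup S.
have DM n' s' : D n' s' <= M by apply: sup_upper_bound => //; exists (n', s').
have M0 : 0 < M by apply: lt_le_trans (DM n s); rewrite subr_gt0.
(* J steps of size M / 2 exceed the oscillation of h, which is at most 2 *)
pose J := (Num.truncn (4 / M)).+1.
have JM : 4 < J%:R * M.
  by rewrite -ltr_pdivrMr//; exact: truncnS_gt.
(* each step along s divides the gap between M and D by at most c *)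
have e0 : 0 < M / 2 * c ^+ J by rewrite mulr_gt0 ?exprn_gt0// divr_gt0.
have [_ [[n' s'] _ <-] /= DMe] := sup_adherent e0 supS.
have step j : (M - D n' (s' + j)%N) * c ^+ j <= M - D n' s'.
  elim: j => [|j IH]; first by rewrite addn0 expr0 mulr1.
  apply: le_trans IH; rewrite exprS mulrA ler_wpM2r ?exprn_ge0 ?(ltW c0)// addnS.
  have : (1 - c) * D n'.+1 (s' + j)%N <= (1 - c) * M.
    by rewrite ler_wpM2l ?DM// subr_ge0 ltW.
  by have := Dh n' (s' + j)%N; lra.
have half j : (j <= J)%N -> M / 2 <= D n' (s' + j)%N.
  move=> jJ; have cj : 0 < c ^+ j by rewrite exprn_gt0.
  have cJj : c ^+ J <= c ^+ j by rewrite ler_wiXn2l// ltW.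
  rewrite -/M in DMe; have := step j; nra.
have grow j : (j <= J)%N -> j%:R * (M / 2) <= h n' (s' + j)%N - h n' s'.
  elim: j => [|j IH] jJ; first by rewrite addn0 mul0r subrr.
  have := IH (ltnW jJ); have := half j (ltnW jJ).
  by rewrite /D addnS -natr1; lra.
have := grow J (leqnn _); have := hb' n' (s' + J)%N; have := hb' n' s'.
by move: JM; lra.
Qed.

(** A bounded solution and its opposite are both nonincreasing in s, so h does
    not depend on s; the equation then gives the same for n. *)
Lemma bounded_harmonic_constant h : harmonic h ->
  (forall n s, `|h n s| <= 1) -> forall n s, h n s = h 0%N 0%N.
Proof.
move=> hh hb.
have hS n s : h n s.+1 = h n s.
  apply/eqP; rewrite eq_le bounded_harmonic_nonincreasing//= -lerN2.
  apply: (@bounded_harmonic_nonincreasing (fun n s => - h n s)) => [n' s'|n' s'].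
    by rewrite (hh n' s'); ring.
  by rewrite normrN.
have hN n s : h n.+1 s = h n s.
  have := hh n s; rewrite hS => H.
  have : (1 - c) * (h n.+1 s - h n s) = 0 by move: H; lra.
  move/eqP; rewrite mulf_eq0 subr_eq0 subr_eq0 => /orP[/eqP c1'|/eqP//].
  by move: c1; rewrite -c1' ltxx.
by elim=> [|n IH] s; [elim: s => // s; rewrite hS|rewrite hN].
Qed.

End bounded_harmonic.

Section geometric.
Context {R : realType}.
Local Open Scope ereal_scope.

Definition geometric_measure (c : R) (mu : {measure set borel_path_space -> \bar R}) :=
  forall x n, mu (prefix_cylinder x n) =
    (c ^+ (vertex x n).-1 * (1 - c) ^+ n.+1)%:E.

Variables (c : R) (mu : probability borel_path_space R).
Hypotheses (c0 : (0 < c)%R) (c1 : (c < 1)%R) (mugeo : geometric_measure c mu).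

Let muoo : mu setT < +oo. Proof. by rewrite probability_setT ltry. Qed.

Lemma geometric_invariant : cylinder_invariant mu.
Proof. by move=> x y n xy; rewrite !mugeo xy. Qed.

(** For saturated A, compare mu restricted to A with mu on cylinders: the
    ratio is a bounded harmonic function, hence a constant k. So
    mu(A /\ B) = k mu(B) for all Borel B, and B := X, then B := A, give
    k = mu(A) = mu(A)^2. *)
Lemma geometric_ergodic : ergodic mu.
Proof.
move=> A mA satA.
have mid : measurable_fun setT (id : borel_path_space -> borel_path_space) by [].
have [m mE] := path_image_measure mu mA mid.
have minv : cylinder_invariant m.
  move=> x y n xy; rewrite !mE !preimage_id ![A `&` _]setIC.
  rewrite [RHS](splice_invariant muoo geometric_invariant xy)//.
  congr (mu (_ `&` _)); apply/seteqP; split=> z /= Az.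
    by apply: satA Az; apply: tail_equivalent_sym; exact: splice_tail_equivalent.
  by apply: satA Az; exact: splice_tail_equivalent.
have mle B : measurable B -> m B <= mu B.
  move=> mB; rewrite mE preimage_id; apply: le_measure; rewrite ?inE//.
  exact: measurableI.
pose w n s : R := (c ^+ s * (1 - c) ^+ n.+1)%R.
have w0 n s : (0 < w n s)%R by rewrite mulr_gt0// exprn_gt0// subr_gt0.
have massle n s : cylinder_mass m n s.+1 <= (w n s)%:E.
  apply: le_trans (mle _ _) _; first exact: measurable_prefix_cylinder.
  by rewrite mugeo vertex_const_path.
have massfin n s : cylinder_mass m n s.+1 \is a fin_num.
  by rewrite ge0_fin_numE ?measure_ge0// (le_lt_trans (massle n s))// ltry.
pose h n s : R := (fine (cylinder_mass m n s.+1) / w n s)%R.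
have massE n s : cylinder_mass m n s.+1 = (h n s * w n s)%:E.
  by rewrite /h divfK ?fineK// gt_eqF.
have h01 n s : (0 <= h n s <= 1)%R.
  apply/andP; split; first by rewrite divr_ge0 ?fine_ge0// ltW.
  by rewrite ler_pdivrMr// mul1r -lee_fin fineK.
have hharm : harmonic c h.
  move=> n s; have := cylinder_mass_harmonic n minv (ltn0Sn s).
  rewrite !massE -EFinD => -[] H; apply: (mulIf (x := w n s)); first by rewrite gt_eqF.
  rewrite H /w (exprS _ s) (exprS _ n.+1); ring.
have hconst : forall n s, h n s = h 0%N 0%N.
  apply: (bounded_harmonic_constant c0 c1 hharm) => n s.
  by have /andP[h0 h1] := h01 n s; rewrite ger0_norm.
set k := h 0%N 0%N in hconst.
have k0 : (0 <= k)%R by have /andP[] := h01 0%N 0%N.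
have mk B : measurable B -> m B = k%:E * mu B.
  move=> mB; rewrite -[RHS]/(mscale (NngNum k0) mu B).
  apply: (measure_cylinder_unique (n := 0)) mB => [|x n _].
    exact: le_lt_trans (mle _ _) muoo.
  rewrite cylinder_massE// -[in LHS](prednK (vertex_gt0 x n)) massE hconst.
  by rewrite -[RHS]/(k%:E * mu _) mugeo EFinM.
have AA : mu A = mu A * mu A.
  have := mk _ measurableT; rewrite mE preimage_id setIT probability_setT mule1 => kE.
  by have := mk _ mA; rewrite mE preimage_id setIid -kE.
have fA : mu A \is a fin_num by exact: fin_num_measure.
move: AA; rewrite -(fineK fA) -EFinM => -[] AA.
have /eqP : (fine (mu A) * (fine (mu A) - 1) = 0)%R by rewrite mulrBr -AA mulr1 subrr.
rewrite mulf_eq0 subr_eq0 => /orP[/eqP->|/eqP->]; [by left|by right].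
Qed.

(** Long cylinders have mass less than mu(A), and one of them meets A in a set
    of positive mass. *)
Lemma geometric_non_atomic : non_atomic mu.
Proof.
move=> A mA A0.
have fA : mu A \is a fin_num by exact: fin_num_measure.
have [n nA] : exists n, ((1 - c) ^+ n.+1 < fine (mu A))%R.
  have : ((1 - c) ^+ n @[n --> \oo] --> (0 : R))%R.
    by apply: cvg_expr; rewrite gtr0_norm ?subr_gt0// gtrBl.
  move=> /cvgr_lt /(_ (fine (mu A))); rewrite fine_gt0; last first.
    by rewrite A0 ltey_eq fA.
  move=> /(_ isT) [N _ HN]; exists N; apply: HN; exact: leqnSn.
have small x : mu (prefix_cylinder x n) < mu A.
  rewrite mugeo -(fineK fA) lte_fin; apply: le_lt_trans nA.
  rewrite ler_piMl ?exprn_ge0 ?subr_ge0 ?(ltW c0) ?(ltW c1)//.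
  by apply: exprn_ile1; exact: ltW.
pose B s : set borel_path_space := A `&` prefix_cylinder (dense_path s) n.
have mB s : measurable (B s).
  by apply: measurableI => //; exact: measurable_prefix_cylinder.
have [s Bs] : exists s, 0 < mu (B s).
  apply/not_existsP => B0; move: A0; apply/negP; rewrite -leNgt.
  have AE : A = \bigcup_s B s by rewrite -setI_bigcupr bigcup_dense_cylinders setIT.
  rewrite [in X in X <= _]AE bigcup_unpickle.
  set P := fun k => oapp _ _ _.
  have mP k : measurable (P k).
    by rewrite /P; case: choice.unpickle => //=; exact: measurable0.
  apply: (@le_trans _ _ (\sum_(k <oo) mu (P k))).
    by apply: measure_sigma_subadditive => //; exact: bigcupT_measurable.
  rewrite eseries0// => k _ _; apply/eqP; rewrite eq_le measure_ge0 andbT /P.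
  case: choice.unpickle => [s|] /=; last by rewrite measure0.
  by rewrite leNgt; apply/negP/B0.
exists (B s); split=> [//|x []//|//|]; apply: le_lt_trans (small (dense_path s)).
apply: le_measure; rewrite ?inE//; first exact: measurable_prefix_cylinder.
by move=> x [].
Qed.

End geometric.

Section dirac.
Context {R : realType}.
Local Open Scope ereal_scope.

(** For c = 0 all the mass sits on the path staying at the vertex 1. *)
Lemma geometric0_atomic (nu : probability borel_path_space R) :
  geometric_measure 0 nu -> ~ non_atomic nu.
Proof.
move=> nugeo natom.
have C1 n : nu (prefix_cylinder path11 n) = 1.
  by rewrite nugeo expr0 subr0 expr1n mulr1.
have mC n := measurableC (measurable_prefix_cylinder path11 n).
pose U := \bigcup_n ~` (prefix_cylinder path11 n : set borel_path_space).
have mU : measurable U by exact: bigcupT_measurable.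
have U0 : nu U = 0.
  apply/eqP; rewrite eq_le measure_ge0 andbT.
  apply: (@le_trans _ _ (\sum_(n <oo) nu (~` prefix_cylinder path11 n))).
    exact: measure_sigma_subadditive.
  rewrite eseries0// => n _ _; rewrite [LHS]probability_setC ?C1 ?subee//.
  exact: measurable_prefix_cylinder.
have nuCU : nu (~` U) = 1 by rewrite [LHS]probability_setC// U0 sube0.
have [|B [mB BU B0]] := natom (~` U) (measurableC mU); first by rewrite nuCU.
have [x Bx] : B !=set0.
  by apply/set0P/eqP => B_0; move: B0; rewrite B_0 measure0 ltxx.
have UE y : (~` U) y -> y = path11.
  move=> nUy; apply: path_ext => k; apply: contrapT => yk; apply: nUy.
  by exists k => // /(_ k (leqnn _)).
suff -> : ~` U = B by rewrite ltxx.
by apply/seteqP; split=> // y /UE ->; rewrite -(UE x (BU x Bx)).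
Qed.

End dirac.

(** * Existence of geometric measures *)

Section probability_of_measure.
Context d (T : measurableType d) (R : realType).
Variables (m : {measure set T -> \bar R}) (mT : (m setT = 1)%E).

(** The argument of type m setT = 1 keys the probability structure to a proof
    of total mass one. *)
Definition probability_of_measure & (m setT = 1)%E : set T -> \bar R := m.

HB.instance Definition _ := Measure.on (probability_of_measure mT).
HB.instance Definition _ :=
  Measure_isProbability.Build _ _ _ (probability_of_measure mT) mT.

End probability_of_measure.

Section coding.
Context {R : realType}.
Variable c : R.
Hypotheses (c0 : 0 < c) (c1 : c < 1).

Let q0 : 0 < 1 - c. Proof. by rewrite subr_gt0. Qed.

Let ck0 k : 0 < c ^+ k. Proof. exact: exprn_gt0. Qed.

(** The intervals [1 - c^k, 1 - c^(k+1)[ have lengths c^k (1-c) and partition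
    [0, 1[, so for a uniform variable u the value digit u is geometric. The map
    [rescale] below sends each of these intervals affinely onto [0, 1[. *)
Definition digit (u : R) : nat :=
  xget 0%N [set k | 1 - c ^+ k <= u < 1 - c ^+ k.+1].

Lemma digit_unique u k : 1 - c ^+ k <= u < 1 - c ^+ k.+1 -> digit u = k.
Proof.
move=> uk; apply: xget_unique => // l.
have aux i j : 1 - c ^+ i <= u < 1 - c ^+ i.+1 -> 1 - c ^+ j <= u < 1 - c ^+ j.+1 ->
    (i <= j)%N.
  move=> /andP[iu ui] /andP[ju uj]; rewrite leqNgt; apply/negP => ji.
  have : c ^+ i <= c ^+ j.+1 by rewrite ler_wiXn2l// ltW.
  lra.
by move=> ul; apply/eqP; rewrite eqn_leq !aux.
Qed.

Lemma digitP u : 0 <= u < 1 -> 1 - c ^+ digit u <= u < 1 - c ^+ (digit u).+1.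
Proof.
move=> /andP[u0 u1].
have exN : exists N, u < 1 - c ^+ N.+1.
  have : (c ^+ n @[n --> \oo] --> (0 : R))%R.
    by apply: cvg_expr; rewrite gtr0_norm.
  move=> /cvgr_lt /(_ (1 - u)); rewrite subr_gt0 => /(_ u1) [N _ HN].
  by exists N; have := HN N.+1 (leqnSn _); rewrite /=; lra.
case: (ex_minnP exN) => k uk kmin.
have ku : 1 - c ^+ k <= u < 1 - c ^+ k.+1.
  rewrite uk andbT; case: k uk kmin => [|k] uk kmin; first by rewrite expr0 subrr.
  by rewrite leNgt; apply/negP => /kmin; rewrite ltnn.
by rewrite (digit_unique ku).
Qed.

Definition rescale (u : R) : R :=
  (u - (1 - c ^+ digit u)) / (c ^+ digit u * (1 - c)).

Definition digits (u : R) (k : nat) : nat := digit (iter k rescale u).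

(** Constant outside [0, 1[, so as to be measurable on the whole line. *)
Definition coding (u : R) : path_space :=
  if 0 <= u < 1 then path_of (fun k => (\sum_(j < k.+1) digits u j).+1)
  else path11.

Lemma vertex_coding u k : 0 <= u < 1 ->
  vertex (coding u) k = (\sum_(j < k.+1) digits u j).+1.
Proof.
move=> u01; rewrite /coding u01 vertex_path_of// => j _.
by rewrite ltnS [leqRHS]big_ord_recr leq_addr.
Qed.

(** Prescribing n digits confines u to an interval whose length is the product
    of the lengths belonging to the digits: pull the interval of the remaining
    digits back through the first affine branch of [rescale]. *)
Lemma digits_itv n (s : nat -> nat) : exists l,
  [/\ 0 <= l, l + c ^+ (\sum_(j < n) s j) * (1 - c) ^+ n <= 1 &
   forall u, (0 <= u < 1 /\ forall k, (k < n)%N -> digits u k = s k) <->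
     l <= u < l + c ^+ (\sum_(j < n) s j) * (1 - c) ^+ n].
Proof.
elim: n s => [|n IH] s.
  exists 0; rewrite big_ord0 !expr0 mulr1 add0r; split=> // u.
  by split=> [[]|].
have [l [l0 l1 lP]] := IH (fun k => s k.+1).
rewrite big_ord_recl /= (eq_bigr (fun j : 'I_n => s j.+1))//.
set t := (\sum_(j < n) s j.+1)%N in l1 lP *; set w := c ^+ t * (1 - c) ^+ n in l1 lP.
pose a := c ^+ s 0%N * (1 - c).
have a0 : 0 < a by rewrite mulr_gt0.
have aE : 1 - c ^+ s 0%N + a = 1 - c ^+ (s 0%N).+1 by rewrite /a exprS; ring.
have -> : c ^+ (s 0%N + t) * (1 - c) ^+ n.+1 = a * w.
  by rewrite /a /w exprD exprS; ring.
have cs1 : c ^+ s 0%N <= 1 by apply: exprn_ile1; exact: ltW.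
have al0 : 0 <= a * l by rewrite mulr_ge0// ltW.
have alw : a * (l + w) <= a by rewrite -[leRHS]mulr1 ler_pM2l.
have cS0 := ck0 (s 0%N).+1.
exists (1 - c ^+ s 0%N + a * l); split; [lra|rewrite mulrDr in alw; lra|move=> u].
have rescaleE : 1 - c ^+ s 0%N <= u < 1 - c ^+ (s 0%N).+1 ->
    u = 1 - c ^+ s 0%N + a * rescale u.
  move=> /digit_unique us; rewrite /rescale us -/a mulrC divfK; last by rewrite gt_eqF.
  by ring.
split=> [[u01 us]|/andP[lu ul]].
  have us0 := us 0%N isT.
  have du := digitP u01; rewrite -[digit u]/(digits u 0) us0 in du.
  have uE := rescaleE du; rewrite {}uE in du *.
  have r01 : 0 <= rescale u < 1.
    move: du; rewrite -aE => /andP[d1 d2]; apply/andP; split.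
      by rewrite -(pmulr_rge0 _ a0); lra.
    by rewrite -(ltr_pM2l a0) mulr1; lra.
  have /lP /andP[lr rl] : 0 <= rescale u < 1 /\
      forall k, (k < n)%N -> digits (rescale u) k = s k.+1.
    by split=> // k kn; rewrite -us// /digits -iterSr.
  have : a * l <= a * rescale u < a * (l + w).
    by rewrite ler_pM2l// ltr_pM2l// lr rl.
  by rewrite mulrDr => /andP[? ?]; apply/andP; split; lra.
have du : 1 - c ^+ s 0%N <= u < 1 - c ^+ (s 0%N).+1.
  apply/andP; split; first lra.
  by rewrite mulrDr in alw; lra.
have uE := rescaleE du.
have : l <= rescale u < l + w.
  by rewrite -(ler_pM2l a0) -(ltr_pM2l a0) mulrDr; apply/andP; split; lra.
move=> /lP[_ rs]; split; first by apply/andP; split; lra.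
by move=> [_|k kn]; [exact: digit_unique|rewrite /digits iterSr; exact: rs].
Qed.

Lemma coding_cylinder x n : exists l,
  `[0, 1[%classic `&` coding @^-1` prefix_cylinder x n =
  `[l, l + c ^+ (vertex x n).-1 * (1 - c) ^+ n.+1[%classic.
Proof.
pose s k := if k is k'.+1 then (vertex x k - vertex x k')%N else (vertex x 0).-1.
have sE k : (\sum_(j < k.+1) s j).+1 = vertex x k.
  elim: k => [|k IH]; first by rewrite big_ord1 prednK// vertex_gt0.
  by rewrite big_ord_recr -addSn IH /= subnKC// vertexS.
have [l [_ _ lP]] := digits_itv n.+1 s.
exists l; rewrite -(sE n) -pred_Sn; apply/seteqP; split=> u /=; rewrite !in_itv /=.
  move=> [u01 ux]; apply/lP; split=> // k.
  elim/ltn_ind: k => k IH kn.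
  have : vertex (coding u) k = (\sum_(j < k.+1) s j).+1 by rewrite ux// sE.
  rewrite vertex_coding// !big_ord_recr => -[].
  rewrite (eq_bigr (fun j : 'I_k => s j)) => [/addnI//|j _].
  by apply: IH => //; apply: ltn_trans kn.
move=> /lP[u01 us]; split=> // k kn; rewrite vertex_coding// -sE; congr S.
by apply: eq_bigr => j _; apply: us; exact: (leq_trans (ltn_ord j)).
Qed.

Lemma measurable_coding :
  measurable_fun setT (coding : measurableTypeR R -> borel_path_space).
Proof.
apply: (@measurability _ _ (measurableTypeR R) borel_path_space _ _
  (deep_cylinders 0)); first exact: borel_deep_cylinders.
move=> _ [_ [->|[x [k [_ ->]]]] <-]; first by rewrite preimage_set0 setI0.
rewrite setTI -(setUIDK (coding @^-1` _) `[0, 1[%classic).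
apply: measurableU.
  by rewrite setIC; have [l ->] := coding_cylinder x k; exact: measurable_itv.
have [x11|x11] := pselect (prefix_cylinder x k path11).
  rewrite (_ : _ `\` _ = ~` `[0, 1[%classic).
    by apply: measurableC; exact: measurable_itv.
  apply/seteqP; split=> u /=; first by case.
  by rewrite in_itv /= /coding => /negP/negbTE u01; rewrite u01.
rewrite (_ : _ `\` _ = set0)//; apply/seteqP; split=> // u /= [].
by rewrite in_itv /= /coding => + /negP/negbTE u01; rewrite u01.
Qed.

Lemma geometric_measure_exists :
  exists mu : probability borel_path_space R, geometric_measure c mu.
Proof.
have mI : measurable (`[0, 1[%classic : set (measurableTypeR R)).
  exact: measurable_itv.
have [m mE] := restricted_image_measure (@lebesgue_measure R) mI measurable_coding.
have mT : (m setT = 1)%E.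
  rewrite [LHS]mE preimage_setT setIT [LHS]lebesgue_measure_itv /= lte_fin ltr01.
  by rewrite oppr0 adde0.
exists (probability_of_measure mT) => x n.
transitivity (m (prefix_cylinder x n)) => //; rewrite [LHS]mE.
have [l ->] := coding_cylinder x n.
rewrite [LHS]lebesgue_measure_itv /= lte_fin ltrDl mulr_gt0 ?exprn_gt0//.
by rewrite -EFinB; congr EFin; ring.
Qed.

End coding.

(** * The classification *)

Section transfer.
Context {R : realType}.
Local Open Scope ereal_scope.
Implicit Types nu mu : probability borel_path_space R.

Lemma tail_invariant_cylinder nu : tail_invariant nu <-> cylinder_invariant nu.
Proof.
split=> [inv x y n xy|inv n i p q].
  have [p <-] := prefix_cylinderE x n; have [q <-] := prefix_cylinderE y n.
  by move: p; rewrite xy => p; exact: inv.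
have [x [k [nk ix ->]]] := cylinderE p; have [y [l [nl iy ->]]] := cylinderE q.
move: nl; rewrite nk => -[kl]; rewrite -{}kl in iy *.
by apply: inv; rewrite -ix.
Qed.

(** The formula for mu_a in terms of c = a / (a + 1), for which
    1 - c = 1 / (a + 1). *)
Lemma is_mu_geometric (a : R) nu : (0 < a)%R ->
  is_mu a nu <-> geometric_measure (a / (a + 1)) nu.
Proof.
move=> a0; have a1 : (a + 1 != 0)%R by rewrite gt_eqF// addr_gt0.
have weight n i : (0 < i)%N ->
    ((a / (a + 1)) ^+ i.-1 * (1 - a / (a + 1)) ^+ n.+1 =
     a ^+ (i - 1) / (a + 1) ^+ (n.+1 + i - 1))%R.
  case: i => // i _; rewrite subn1 addnS subn1 /= addnC exprD.
  have -> : (1 - a / (a + 1) = (a + 1)^-1)%R by field.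
  by rewrite expr_div_n exprVn invfM mulrA.
split=> [[_ nuE] x n|nuE].
  by have [p <-] := prefix_cylinderE x n; rewrite [LHS]nuE weight// vertex_gt0.
split; first by apply/tail_invariant_cylinder; exact: geometric_invariant nuE.
move=> n i p; have [x [k [nk ix ->]]] := cylinderE p; rewrite nk ix.
by rewrite [LHS]nuE weight// vertex_gt0.
Qed.

Lemma geometric_unique (c : R) nu mu :
  geometric_measure c nu -> geometric_measure c mu -> borel_eq nu mu.
Proof.
move=> nuE muE; apply: (measure_cylinder_unique (n := 0)) => [|x n _].
  by rewrite [ltLHS]probability_setT ltry.
by rewrite [LHS]nuE [RHS]muE.
Qed.

Lemma geometric_borel_eq (c : R) nu mu :
  borel_eq nu mu -> geometric_measure c mu -> geometric_measure c nu.
Proof.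
move=> e muE x n; rewrite -muE; apply: e; exact: measurable_prefix_cylinder.
Qed.

(** Of the values c given by [ergodic_cylinder_mass], 0 is excluded because it
    gives a Dirac mass, and 1 because every cylinder would be null. *)
Lemma ergodic_is_geometric nu :
  [/\ non_atomic nu, tail_invariant nu & ergodic nu] ->
  exists2 c : R, (0 < c < 1)%R & geometric_measure c nu.
Proof.
move=> [natom /tail_invariant_cylinder inv erg].
have [c /andP[c0 c1] massE] := ergodic_cylinder_mass inv erg.
have nuE : geometric_measure c nu.
  by move=> x n; rewrite cylinder_massE// massE// vertex_gt0.
exists c => //; apply/andP; split; rewrite lt_neqAle ?c0 ?c1 andbT.
  apply/eqP => c00; rewrite -c00 in nuE; exact: geometric0_atomic nuE natom.
apply/eqP => c11; rewrite c11 in nuE.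
have : nu setT = 0.
  rewrite (measure_fibers nu 0 measurableT) eseries0// => j _ _.
  have [j0|j0] := posnP j.
    rewrite (_ : _ `&` _ = set0) ?measure0//; apply/seteqP; split=> // x [_ /=].
    by have := vertex_gt0 x 0; rewrite j0; case: vertex.
  rewrite setTI (_ : [set x | _] = prefix_cylinder (const_path j) 0).
    by rewrite nuE subrr expr1 mulr0.
  apply/seteqP; split=> x /=; last by move=> ->//; rewrite vertex_const_path.
  by move=> xj k; rewrite leqn0 => /eqP ->; rewrite vertex_const_path.
by rewrite probability_setT => -[] /eqP; rewrite oner_eq0.
Qed.

End transfer.

Theorem theorem8p7 (R : realType) :
  exists mu : R -> probability borel_path_space R,
    (forall a : R, 0 < a ->
       is_mu a (mu a) /\
       forall nu : probability borel_path_space R,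
         is_mu a nu -> borel_eq nu (mu a)) /\
    (forall nu : probability borel_path_space R,
       [/\ non_atomic nu, tail_invariant nu & ergodic nu] <->
       exists a : R, 0 < a /\ borel_eq nu (mu a)).
Proof.
have param (a : R) : 0 < a -> 0 < a / (a + 1) < 1.
  move=> a0; have a10 : 0 < a + 1 by rewrite addr_gt0.
  by rewrite divr_gt0//= ltr_pdivrMr// mul1r ltrDl.
have exmu (a : R) : exists mu : probability borel_path_space R,
    0 < a -> geometric_measure (a / (a + 1)) mu.
  have [a0|a0] := ltP 0 a.
    have /andP[c0 c1] := param a a0.
    by have [mu muE] := geometric_measure_exists c0 c1; exists mu.
  (* for a <= 0 any probability measure will do *)
  have half0 : (0 : R) < 2^-1 by rewrite invr_gt0.
  have half1 : (2^-1 : R) < 1 by lra.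
  by have [mu _] := geometric_measure_exists half0 half1; exists mu.
have [mu muE] := choice exmu; exists mu; split=> [a a0|nu].
  split=> [|nu]; first by apply/is_mu_geometric => //; exact: muE.
  by move=> /(is_mu_geometric _ a0) nuE; exact: geometric_unique nuE (muE a a0).
split=> [/ergodic_is_geometric[c /andP[c0 c1] nuE]|[a [a0 e]]].
  have d0 : 0 < 1 - c by rewrite subr_gt0.
  have a0 : 0 < c / (1 - c) by rewrite divr_gt0.
  exists (c / (1 - c)); split=> //.
  have ac : c / (1 - c) / (c / (1 - c) + 1) = c by field; lra.
  by apply: (geometric_unique (c := c)) => //; have := muE _ a0; rewrite ac.
have /andP[c0 c1] := param a a0.
have nuE := geometric_borel_eq e (muE a a0).
split; [exact: geometric_non_atomic c0 c1 nuE| |exact: geometric_ergodic c0 c1 nuE].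
by apply/tail_invariant_cylinder; exact: geometric_invariant nuE.
Qed.
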